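(* The set $\Omega_P\cup\Omega_Q\subset\mathbb{R}^2$ has Hausdorff dimension exactly $1$ (in particular it has two-dimensional Lebesgue measure zero).
   Context: For real parameters $a,b$, the map $T_{ab}:\mathbb{R}^2\to\mathbb{R}^2$ is $T_{ab}(x,y)=(ax-y,x)$ if $x\ge 0$ and $T_{ab}(x,y)=(bx-y,x)$ if $x<0$; $T_{ab}^{(k)}$ is its $k$-th iterate. $S_{ab}:S^1\to S^1$, $S_{ab}(\mathbf{u})=T_{ab}(\mathbf{u})/|T_{ab}(\mathbf{u})|$, and $r(S_{ab})$ is its Poincaré rotation number. $\Omega_P$ is the set of $(a,b)\in\mathbb{R}^2$ for which $T_{ab}$ is periodic, i.e. $T_{ab}^{(k)}$ is the identity for some $k\ge1$. $\Omega_Q$ is the set of $(a,b)\in\mathbb{R}^2$ for which $r(S_{ab})$ is irrational and the $S_{ab}$-orbit of $(0,1)$ contains $(0,-1)$. *)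

(* Defs.v *)
From HB Require Import structures.
From mathcomp Require Import all_boot all_order all_algebra.
From mathcomp Require Import all_classical all_reals all_analysis.
Set Implicit Arguments. Unset Strict Implicit. Unset Printing Implicit Defensive.
Import Order.TTheory GRing.Theory Num.Theory.
Import numFieldNormedType.Exports.
Local Open Scope classical_set_scope.
Local Open Scope ring_scope.

Section Defs.
Variable R : realType.

Definition Tab (a b : R) (p : R * R) : R * R :=
  if 0 <= p.1 then (a * p.1 - p.2, p.1) else (b * p.1 - p.2, p.1).

Definition norm2 (p : R * R) : R := Num.sqrt (p.1 ^+ 2 + p.2 ^+ 2).
Definition dist2 (p q : R * R) : R := norm2 (p.1 - q.1, p.2 - q.2).

Definition Sab (a b : R) (u : R * R) : R * R :=
  let v := Tab a b u in (v.1 / norm2 v, v.2 / norm2 v).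

Definition ecirc (t : R) : R * R := (cos (2 * pi * t), sin (2 * pi * t)).

Definition is_lift (a b : R) (F : R -> R) : Prop :=
  continuous F /\ (forall t, F (t + 1) = F t + 1) /\
  (forall t, Sab a b (ecirc t) = ecirc (F t)).

Definition irrational (x : R) : Prop := ~ exists q : rat, x = ratr q.

(* The Poincare rotation number r(S_ab) is irrational: it is the class mod 1 of
   lim_n F^n(0)/n for a lift F of S_ab. *)
Definition rot_irrational (a b : R) : Prop :=
  exists (F : R -> R) (rho : R), is_lift a b F /\
    ((fun n : nat => iter n F 0 / n%:R) @ \oo --> rho) /\ irrational rho.

Definition Omega_P : set (R * R) :=
  [set ab | exists k : nat, (0 < k)%N /\ forall p, iter k (Tab ab.1 ab.2) p = p].

Definition Omega_Q : set (R * R) :=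
  [set ab | rot_irrational ab.1 ab.2 /\
            exists n : nat, iter n (Sab ab.1 ab.2) (0, 1) = (0, -1)].

Definition diam (A : set (R * R)) : \bar R :=
  ereal_sup [set (dist2 pq.1 pq.2)%:E | pq in A `*` A].

Definition diam_pow (s : R) (A : set (R * R)) : \bar R :=
  if pselect (A = set0) then 0%E else
  match diam A with
  | EFin d => (d `^ s)%:E
  | +oo%E => +oo%E
  | -oo%E => 0%E
  end.

Definition hausdorff_delta (s delta : R) (E : set (R * R)) : \bar R :=
  ereal_inf [set (\sum_(0 <= i <oo) diam_pow s (U i))%E |
             U in [set U : nat -> set (R * R) |
                     E `<=` \bigcup_i U i /\ forall i, (diam (U i) <= delta%:E)%E]].

Definition hausdorff_measure (s : R) (E : set (R * R)) : \bar R :=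
  ereal_sup [set hausdorff_delta s delta E | delta in [set d : R | 0 < d]].

Definition hausdorff_dim (E : set (R * R)) : \bar R :=
  ereal_inf [set s%:E | s in [set s : R | 0 <= s /\ hausdorff_measure s E = 0%E]].

End Defs.

(* Main.v *)
(** Upper bound: along a fixed sequence of branches, the first coordinate of
    [T^n (0, 1)] is a polynomial in [(a, b)]; it is nonzero because on the
    diagonal [a = b] it has exact degree [n - 1].  It vanishes at every parameter
    of [Omega_P] or [Omega_Q] for some [n >= 1], so the set lies in a countable
    union of plane algebraic curves, and these are countable unions of Lipschitz
    graphs, hence null for the [s]-dimensional Hausdorff measure when [s > 1].

    Lower bound: for [b = 0] and [a = 2 cos theta] the orbit of [(0, 1)] reaches
    [(0, -1)] in two steps, and [T] acts as the rotation [r |-> r + theta] on an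
    invariant closed curve of period [pi + 2 theta].  The rotation number is
    therefore [theta / (pi + 2 theta)], which is irrational for all but countably
    many [a], so the set contains almost all of the segment [-1 <= a <= 1] of the
    axis [b = 0]. *)
Require Import Defs.
From mathcomp Require Import all_boot all_order all_algebra.
From mathcomp Require Import all_classical all_reals all_analysis.
From mathcomp Require Import ring lra.
Import Order.TTheory GRing.Theory Num.Theory.
Import numFieldNormedType.Exports.
Local Open Scope classical_set_scope.
Local Open Scope ring_scope.
Set Implicit Arguments. Unset Strict Implicit. Unset Printing Implicit Defensive.

(** * Sets of zero Hausdorff measure and criteria for them *)

Section HausdorffNull.
Variable R : realType.
Implicit Types (s : R) (E A : set (R * R)).

Lemma norm2_ge0 (p : R * R) : 0 <= norm2 p.
Proof. exact: sqrtr_ge0. Qed.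

Lemma dist2_ge0 (p q : R * R) : 0 <= dist2 p q.
Proof. exact: norm2_ge0. Qed.

Lemma norm2_le_add (x y : R) : norm2 (x, y) <= `|x| + `|y|.
Proof.
rewrite /norm2 /=.
have h : 0 <= `|x| + `|y| by rewrite addr_ge0.
rewrite -[leRHS](ger0_norm h) -sqrtr_sqr ler_sqrt ?sqr_ge0//.
rewrite sqrrD !real_normK ?num_real//.
have : 0 <= `|x| * `|y| by rewrite mulr_ge0.
lra.
Qed.

Lemma normr_le_norm2 (x y : R) : `|x| <= norm2 (x, y).
Proof. by rewrite /norm2 /= -sqrtr_sqr ler_sqrt ?addr_ge0 ?sqr_ge0// lerDl sqr_ge0. Qed.

Lemma diam_ge A p q : A p -> A q -> ((dist2 p q)%:E <= diam A)%E.
Proof. by move=> Ap Aq; apply: (@ereal_sup_ubound R); exists (p, q). Qed.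

Lemma diam_le A (d : R) : (forall p q, A p -> A q -> dist2 p q <= d) ->
  (diam A <= d%:E)%E.
Proof.
move=> h; apply: ge_ereal_sup => x [[p q] [/= Ap Aq] <-].
by rewrite lee_fin h.
Qed.

Lemma diam_pow_ge0 s A : (0 <= diam_pow s A)%E.
Proof.
rewrite /diam_pow; case: pselect => // A0; case: (diam A) => //= r.
by rewrite lee_fin powR_ge0.
Qed.

Lemma diam_pow_le s A (d : R) : 0 <= s ->
  (forall p q, A p -> A q -> dist2 p q <= d) -> (diam_pow s A <= (d `^ s)%:E)%E.
Proof.
move=> s0 h; rewrite /diam_pow; case: pselect => [A0|A0].
  by rewrite lee_fin powR_ge0.
have [p Ap] : A !=set0 by apply/set0P/eqP.
have := diam_le h; have := diam_ge Ap Ap.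
case: (diam A) => //= r; rewrite !lee_fin => h0 hr.
have r0 : 0 <= r := le_trans (dist2_ge0 _ _) h0.
by rewrite ge0_ler_powR// nnegrE// (le_trans r0).
Qed.

(** Vanishing of [hausdorff_measure s E] with the infimum and supremum unfolded into explicit
    coverings; the equivalence is [hausdorff_measure_eq0] together with [hnull_of_measure_eq0]. *)
Definition hnull s E := forall delta eps : R, 0 < delta -> 0 < eps ->
  exists U : nat -> set (R * R),
    [/\ E `<=` \bigcup_i U i, (forall i, (diam (U i) <= delta%:E)%E) &
        (\sum_(0 <= i <oo) diam_pow s (U i) <= eps%:E)%E].

Lemma hausdorff_delta_ge0 s d E : (0 <= hausdorff_delta s d E)%E.
Proof.
apply: le_ereal_inf_tmp => x [U _ <-].
by apply: nneseries_ge0 => n _ _; exact: diam_pow_ge0.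
Qed.

Lemma hausdorff_measure_eq0 s E : hnull s E -> hausdorff_measure s E = 0%E.
Proof.
move=> h; apply/eqP; rewrite eq_le; apply/andP; split.
  apply: ge_ereal_sup => x [d /= d0 <-].
  apply/lee_addgt0Pr => e e0; rewrite add0e.
  have [U [EU dU sU]] := h d e d0 e0.
  by apply: le_trans sU; apply: (@ereal_inf_lbound R); exists U.
apply: le_trans (hausdorff_delta_ge0 s 1 E) _.
apply: (@ereal_sup_ubound R) => /=; exists 1 => //.
Qed.

Lemma hnull_of_measure_eq0 s E : hausdorff_measure s E = 0%E -> hnull s E.
Proof.
move=> h d e d0 e0.
have hd : (hausdorff_delta s d E < e%:E)%E.
  apply: (@le_lt_trans _ _ 0%E); last by rewrite lte_fin.
  by rewrite -h; apply: (@ereal_sup_ubound R); exists d.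
have [_ [U [EU dU] <-] lt] := ereal_inf_lt hd.
by exists U; split => //; exact: ltW.
Qed.

Lemma hnull_subset s E E' : E `<=` E' -> hnull s E' -> hnull s E.
Proof.
move=> EE' h d e d0 e0; have [U [EU dU sU]] := h d e d0 e0.
by exists U; split => //; exact: subset_trans EU.
Qed.

Lemma hnull_set0 s : hnull s set0.
Proof.
move=> d e d0 e0; exists (fun=> set0); split => //.
  move=> _; apply: diam_le => //.
rewrite eseries0 ?lee_fin ?ltW// => i _ _.
by rewrite /diam_pow; case: pselect.
Qed.

(** The [n]-th set is covered at cost [e / 2 ^ n.+1], and a bijection of [nat] with [nat * nat]
    merges the coverings into one sequence. *)
Lemma hnull_bigcup_nat s (F : nat -> set (R * R)) :
  (forall n, hnull s (F n)) -> hnull s (\bigcup_n F n).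
Proof.
move=> h d e d0 e0.
have /choice[G PG] : forall n, exists U : nat -> set (R * R),
    [/\ F n `<=` \bigcup_i U i, (forall i, (diam (U i) <= d%:E)%E) &
        (\sum_(0 <= i <oo) diam_pow s (U i) <= (e / (2 ^ n.+1)%:R)%:E)%E].
  by move=> n; apply: h => //; rewrite divr_gt0// ltr0n expn_gt0.
have /card_esym/ppcard_eqP[f] := card_nat2.
exists (fun k => G (f k).1 (f k).2); split.
- move=> t [i _ Fit]; have [/(_ _ Fit)[j _ Gijt] _ _] := PG i.
  by exists (f^-1%FUN (i, j)) => //=; rewrite invK ?inE.
- by move=> k; have [_ ->] := PG (f k).1.
rewrite nneseries_esumT; last by move=> *; exact: diam_pow_ge0.
rewrite -(@reindex_esum _ _ _ _ setT f (fun ij => diam_pow s (G ij.1 ij.2)));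
  last exact: 'bij_f.
have -> : [set: nat * nat] = setT `*`` (fun=> setT) by apply/seteqP; split.
rewrite -(@esum_esum _ _ _ setT (fun=> setT) (fun i j => diam_pow s (G i j)));
  last by move=> *; exact: diam_pow_ge0.
apply: le_trans (epsilon_trick0 xpredT (ltW e0)).
rewrite -nneseries_esumT; last first.
  by move=> *; apply: esum_ge0 => *; exact: diam_pow_ge0.
apply: lee_nneseries => [*|i _].
  by apply: esum_ge0 => *; exact: diam_pow_ge0.
rewrite -nneseries_esumT; last by move=> *; exact: diam_pow_ge0.
by have [] := PG i.
Qed.

Lemma hnull_bigcup (I : countType) s (F : I -> set (R * R)) :
  (forall i, hnull s (F i)) -> hnull s (\bigcup_i F i).
Proof.
move=> h; pose G n := if unpickle n is Some i then F i else set0.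
apply: (@hnull_subset s _ (\bigcup_n G n)) => [t [i _ Fit]|].
  by exists (pickle i) => //; rewrite /G pickleK.
apply: hnull_bigcup_nat => n; rewrite /G; case: unpickle => [i|]; first exact: h.
exact: hnull_set0.
Qed.

(* The strips of height [1/m] of [Z] have diameter at most [C/m], and there are
   [m] of them, so the covering sum is [C^s m^(1-s)]. *)
Lemma hnull_graph s (C c : R) (h : R * R -> R) (Z : set (R * R)) : 1 < s -> 0 < C ->
  (forall p q, Z p -> Z q -> dist2 p q <= C * `|h p - h q|) ->
  (forall p, Z p -> c <= h p < c + 1) -> hnull s Z.
Proof.
move=> s1 C0 Zh Zc d e d0 e0.
have s0 : 0 < s by lra.
(* This threshold solves [C * x0 ^ (s - 1) = e]. Once [C / m <= x0], the covering sum
   [m * (C / m) ^ s = C * (C / m) ^ (s - 1)] is at most [e]; this is where [1 < s] enters. *)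
pose x0 := (e / C) `^ (s - 1)^-1.
have x00 : 0 < x0 by rewrite powR_gt0// divr_gt0.
have [m [m0 md mx]] : exists m, [/\ (0 < m)%N, C / m%:R <= d & C / m%:R <= x0].
  exists (Num.truncn (C / Num.min d x0)).+1.
  have mn0 : 0 < Num.min d x0 by rewrite lt_min d0.
  have : C / (Num.truncn (C / Num.min d x0)).+1%:R <= Num.min d x0.
    rewrite ler_pdivrMr// mulrC -ler_pdivrMr//.
    by apply: ltW; apply: truncnS_gt.
  by rewrite le_min => /andP[].
have mR : 0 < m%:R :> R by rewrite ltr0n.
pose U i : set (R * R) := [set p | Z p /\ (i < m)%N /\
  c + i%:R / m%:R <= h p < c + i.+1%:R / m%:R].
have dU i p q : U i p -> U i q -> dist2 p q <= C / m%:R.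
  move=> [Zp [_ hp]] [Zq [_ hq]]; apply: (le_trans (Zh _ _ Zp Zq)).
  rewrite ler_pM2l//.
  move: hp hq; rewrite -natr1 mulrDl mul1r => /andP[? ?] /andP[? ?].
  by rewrite ler_norml; apply/andP; split; lra.
exists U; split.
- move=> p Zp; have /andP[cp pc] := Zc _ Zp.
  have xp0 : 0 <= (h p - c) * m%:R by rewrite mulr_ge0// subr_ge0.
  have /andP[t1 t2] := truncn_itv xp0.
  exists (Num.truncn ((h p - c) * m%:R)) => //; split => //; split.
    rewrite -(ltr_nat R); apply: (le_lt_trans t1).
    by rewrite -[ltRHS]mul1r ltr_pM2r//; lra.
  rewrite -lerBrDl -ltrBlDl ler_pdivrMr// ltr_pdivlMr//.
  by rewrite t1 t2.
- move=> i; apply: (@le_trans _ _ (C / m%:R)%:E); last by rewrite lee_fin.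
  by apply: diam_le => p q; exact: dU.
(* The strips of index at least [m] are empty, and [diam_pow] of the empty set is 0 by convention,
   so the series is a finite sum. *)
have U0 i : (m <= i)%N -> diam_pow s (U i) = 0%E.
  move=> mi; rewrite /diam_pow; case: pselect => // -[]; apply/seteqP; split => // p.
  by move=> [_ [im _]]; move: im; rewrite ltnNge mi.
have Cm : (C / m%:R) `^ s * m%:R <= e.
  have y0 : 0 < C / m%:R by rewrite divr_gt0.
  rewrite -[s](subrK 1) powRD; last by apply/implyP => _; rewrite gt_eqF.
  rewrite (powRr1 (ltW y0)) -mulrA divfK ?gt_eqF// -ler_pdivlMr//.
  have -> : e / C = x0 `^ (s - 1).
    by rewrite -powRrM mulVf ?subr_eq0 ?gt_eqF// powRr1// ltW// divr_gt0.
  by apply: ge0_ler_powR; rewrite ?nnegrE ?subr_ge0//; exact: ltW.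
rewrite (@nneseries_split_cond R _ 0 m xpredT); last by move=> *; exact: diam_pow_ge0.
rewrite [X in (_ + X)%E]eseries0 ?adde0; last first.
  by move=> i mi _; exact: U0.
rewrite add0n.
apply: (@le_trans _ _ (\sum_(0 <= i < m) ((C / m%:R) `^ s)%:E)%E).
  by apply: lee_sum => i _; apply: diam_pow_le; [exact: ltW|exact: dU].
by rewrite sumEFin lee_fin sumr_const_nat subn0 -[leLHS]mulr_natr.
Qed.

(** The local estimate becomes uniform after a countable splitting: fix [n], then a grid cell of
    side [1 / n.+1], then a unit interval of values of [h]. Two points of one piece are close enough
    for the estimate, so [hnull_graph] applies to each piece. *)
Lemma hnull_local_graph s (h : R * R -> R) (X : set (R * R)) : 1 < s ->
  (forall p, X p -> exists n : nat, forall q, X q ->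
     `|p.1 - q.1| < n.+1%:R^-1 -> `|p.2 - q.2| < n.+1%:R^-1 ->
     dist2 p q <= n.+1%:R * `|h p - h q|) ->
  hnull s X.
Proof.
move=> s1 hX.
pose Z (t : nat * int * int * int) : set (R * R) := let: (n, i, j, k) := t in
  [set p | [/\ X p, forall q, X q ->
     `|p.1 - q.1| < n.+1%:R^-1 -> `|p.2 - q.2| < n.+1%:R^-1 ->
     dist2 p q <= n.+1%:R * `|h p - h q|,
     Num.floor (n.+1%:R * p.1) = i, Num.floor (n.+1%:R * p.2) = j &
     Num.floor (h p) = k]].
apply: (@hnull_subset s _ (\bigcup_t Z t)) => [p Xp|].
  have [n hn] := hX p Xp.
  by exists (n, Num.floor (n.+1%:R * p.1), Num.floor (n.+1%:R * p.2), Num.floor (h p)).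
apply: hnull_bigcup => -[[[n i] j] k].
have close (x y : R) : Num.floor (n.+1%:R * x) = Num.floor (n.+1%:R * y) ->
    `|x - y| < n.+1%:R^-1.
  move=> xy; rewrite -[X in _ < X]mul1r ltr_pdivlMr// mulrC.
  rewrite -[X in X * _]ger0_norm// -normrM mulrBr.
  have := floor_itv (n.+1%:R * x); have := floor_itv (n.+1%:R * y).
  rewrite xy intrD => /andP[? ?] /andP[? ?].
  by rewrite ltr_norml; apply/andP; split; lra.
apply: (@hnull_graph s n.+1%:R k%:~R h) => //.
  by move=> p q [Xp hp p1 p2 _] [Xq _ q1 q2 _]; apply: hp => //; apply: close; congruence.
move=> p [_ _ _ _ <-]; have := floor_itv (h p); by rewrite intrD.
Qed.

End HausdorffNull.

(** * Zero sets of polynomials *)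

Section ZeroSets.
Variable R : realType.
Implicit Types (P G : {poly {poly R}}) (p q : R * R).

Definition bieval P p : R := P.[p.1%:P].[p.2].

Lemma continuous_bieval P : continuous (bieval P).
Proof.
move=> p.
have -> : bieval P = fun q => \sum_(i < size P) (P`_i).[q.2] * q.1 ^+ i.
  apply/funext => q; rewrite /bieval (horner_coef P) horner_sum.
  by apply: eq_bigr => i _; rewrite hornerM -polyC_exp hornerC.
apply: cvg_big => [|i _]; first exact: add_continuous.
apply: cvgM.
  by apply: continuous_comp; [exact: cvg_snd|exact: continuous_horner].
by apply: (@continuous_comp _ _ _ fst (fun x : R => x ^+ i));
  [exact: cvg_fst|exact: exprn_continuous].
Qed.

Lemma hnull_near_graph (s : R) (h : R * R -> R) (X : set (R * R)) : 1 < s ->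
  (forall p, X p -> exists C : R, \forall q \near p, X q ->
     dist2 p q <= C * `|h p - h q|) ->
  hnull s X.
Proof.
move=> s1 hX; apply: (@hnull_local_graph R s h) => // p Xp.
have [C /nbhs_ballP[e /= e0 hC]] := hX p Xp.
exists (Num.truncn (Num.max C e^-1)) => q Xq p1 p2.
set n := Num.truncn _ in p1 p2 *.
have : Num.max C e^-1 <= n.+1%:R by apply: ltW; exact: truncnS_gt.
rewrite ge_max => /andP[Cn en].
have ne : n.+1%:R^-1 <= e by rewrite -[e]invrK lef_pV2 ?posrE ?invr_gt0.
apply: (le_trans (hC q _ Xq)); last by rewrite ler_wpM2r.
by split; rewrite /= /ball /=; exact: lt_le_trans ne.
Qed.

(* Implicit function theorem for polynomials:
   [P = ('X - a) * G + (Y - b) * H(Y)] with [G(a, b) = P'(a, b) != 0]. *)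
Lemma hnull_regular_zeros (s : R) P : 1 < s ->
  hnull s [set p | bieval P p = 0 /\ bieval P^`() p != 0].
Proof.
move=> s1; apply: (@hnull_near_graph s snd) => // -[a b] /= [P0 dP0].
have [G PG] : exists G, P - P.[a%:P]%:P = G * ('X - a%:P%:P).
  by apply/factor_theorem; rewrite /root !hornerE subrr.
have [H PH] : exists H, P.[a%:P] = H * ('X - b%:P).
  by apply/factor_theorem; apply/eqP.
have Gab : bieval G (a, b) != 0.
  move: dP0; rewrite -(subrK P.[a%:P]%:P P) PG derivD derivC derivM derivXsubC /bieval /=.
  by rewrite !hornerE subrr !(mulr0, add0r, addr0, mulr1, horner0).
(* Near [(a, b)], [G] stays above half its absolute value there and [H] below [|H(b)| + 1] in
   absolute value. The quotient bounds [|q.1 - a|] by a multiple of [|q.2 - b|]; the final 1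
   accounts for [|q.2 - b|] itself. *)
exists ((`|H.[b]| + 1) / (`|bieval G (a, b)| / 2) + 1).
near=> q => -[Pq _].
have Gq : `|bieval G (a, b)| / 2 < `|bieval G q|.
  near: q; apply: cvgr_norm_gt; first exact: continuous_bieval.
  by have : 0 < `|bieval G (a, b)| by [rewrite normr_gt0]; lra.
have Hq : `|H.[q.2]| < `|H.[b]| + 1.
  near: q; apply: (@cvgr_norm_lt _ _ _ _ _ (fun q : R * R => H.[q.2]) H.[b]).
    by apply: (@continuous_comp _ _ _ snd); [exact: cvg_snd|exact: continuous_horner].
  by rewrite ltrDl.
set g := `|bieval G (a, b)| / 2 in Gq *.
have g0 : 0 < g by rewrite divr_gt0// normr_gt0.
have e : bieval G q * (q.1 - a) = - (H.[q.2] * (q.2 - b)).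
  move: Pq; rewrite -(subrK P.[a%:P]%:P P) PG PH /bieval !hornerE /= => h.
  by apply/eqP; rewrite -subr_eq0 opprK; apply/eqP; rewrite -[RHS]h; ring.
have : `|q.1 - a| * g <= (`|H.[b]| + 1) * `|q.2 - b|.
  apply: (@le_trans _ _ (`|H.[q.2]| * `|q.2 - b|)); last first.
    by rewrite ler_wpM2r// ltW.
  by rewrite -normrM -[leRHS]normrN -e normrM mulrC ler_wpM2r// ltW.
rewrite -ler_pdivlMr// => le; rewrite /dist2.
apply: (le_trans (norm2_le_add _ _)) => /=.
rewrite (distrC a) (distrC b) mulrDl mul1r lerD2r.
by rewrite mulrAC.
Unshelve. all: by end_near. Qed.

(** Dividing [l] by the full power of ['X - b] leaves a factor that is nonzero near [b], so locally
    the zero set is the horizontal line at height [b]. *)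
Lemma hnull_horizontal (s : R) (l : {poly R}) : 1 < s -> l != 0 ->
  hnull s [set p : R * R | l.[p.2] = 0].
Proof.
move=> s1 l0; apply: (@hnull_near_graph s fst) => // -[a b] /= lb.
have [m [h hb lh]] := multiplicity_XsubC l b.
move: hb; rewrite l0 /= => hb.
exists 1; near=> q => lq.
have hq : h.[q.2] != 0.
  near: q; apply: (@cvgr_neq0 _ _ _ _ _ (fun q : R * R => h.[q.2]) h.[b]) => //.
  by apply: (@continuous_comp _ _ _ snd); [exact: cvg_snd|exact: continuous_horner].
have qb : q.2 = b.
  move: lq; rewrite lh hornerM horner_exp hornerXsubC => /eqP.
  rewrite mulf_eq0 (negbTE hq) /= expf_eq0 => /andP[_].
  by rewrite subr_eq0 => /eqP.
rewrite /dist2; apply: (le_trans (norm2_le_add _ _)) => /=.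
by rewrite qb subrr normr0 addr0 mul1r.
Unshelve. all: by end_near. Qed.

(** At a zero of [P], either some iterated derivative in the first coordinate vanishes while the
    next does not, which is the regular case, or all of them vanish. The last nonzero derivative is
    a factorial times the leading coefficient, so the second case puts the point on a horizontal
    line. *)
Lemma hnull_zeros (s : R) P : 1 < s -> P != 0 -> hnull s [set p | bieval P p = 0].
Proof.
move=> s1 P0.
pose F (i : option nat) : set (R * R) := if i is Some i then
  [set p | bieval P^`(i) p = 0 /\ bieval P^`(i)^`() p != 0]
  else [set p | (lead_coef P).[p.2] = 0].
apply: (@hnull_subset _ s _ (\bigcup_i F i)) => [p Pp|]; last first.
  apply: hnull_bigcup => -[i|]; first exact: hnull_regular_zeros.
  by apply: hnull_horizontal; rewrite ?lead_coef_eq0.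
have [[i hi]|nex] := pselect (exists i, F (Some i) p); first by exists (Some i).
have all0 i : bieval P^`(i) p = 0.
  elim: i => [//|i IH]; apply/eqP/negP => /negP h.
  by apply: nex; exists i; split.
exists None => //=; have := all0 (size P).-1.
have -> : P^`((size P).-1) = (lead_coef P *+ ((size P).-1)`!)%:P.
  apply/polyP => i; rewrite coef_derivn coefC; case: i => [|i].
    by rewrite addn0 ffactnn.
  rewrite nth_default ?mul0rn// addnS -addSn prednK ?leq_addr//.
  by rewrite size_poly_gt0.
rewrite /bieval hornerC hornerMn => /eqP; rewrite mulrn_eq0.
by rewrite eqn0Ngt fact_gt0 => /eqP.
Qed.

End ZeroSets.

(** * The orbit of [(0, 1)] as polynomials in the parameters, and the upper bound *)

Section Orbit.
Variable R : realType.

Definition letter (c : bool) : {poly {poly R}} := if c then 'X else 'X%:P.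

(* [(word_poly w).1] is the first coordinate of the point reached from [(0, 1)]
   along the branches recorded in [w] (last branch first), as a polynomial in
   [a] over polynomials in [b]. *)
Fixpoint word_poly (w : seq bool) : {poly {poly R}} * {poly {poly R}} :=
  if w is c :: w' then
    (letter c * (word_poly w').1 - (word_poly w').2, (word_poly w').1)
  else (0, 1).

(* On the diagonal [a = b] the word polynomials are Chebyshev-like, of exact
   degree [size w - 1]. *)
Lemma size_word_poly (w : seq bool) : w != [::] ->
  size (word_poly w).1.['X] = size w /\ (size (word_poly w).2.['X] < size w)%N.
Proof.
elim: w => // c [|c' w] IH _.
  by rewrite /= mulr0 sub0r hornerN hornerC size_opp size_poly1 horner0 size_poly0.
have [//|e1 e2] := IH.
have -> : word_poly (c :: c' :: w) =
  (letter c * (word_poly (c' :: w)).1 - (word_poly (c' :: w)).2,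
   (word_poly (c' :: w)).1) by [].
move: {IH} (word_poly (c' :: w)) e1 e2 => [x y] /= e1 e2.
split; last by rewrite e1.
have lx : (letter c * x).['X] = x.['X] * 'X.
  by rewrite hornerM mulrC /letter; case: c; rewrite ?hornerX ?hornerC.
have sx : size (x.['X] * 'X) = (size w).+2.
  by rewrite size_mulX ?e1// -size_poly_gt0 e1.
by rewrite hornerD hornerN lx size_polyDl// size_opp sx ltnW.
Qed.

Lemma word_poly_neq0 (w : seq bool) : w != [::] -> (word_poly w).1 != 0.
Proof.
move=> w0; have [+ _] := size_word_poly w0.
by apply: contra_eq_neq => ->; rewrite horner0 size_poly0 eq_sym size_eq0.
Qed.

(** The word records the signs met along the orbit, so it varies with [(a, b)]; this is harmless
    because there are only countably many words. *)
Lemma iter_Tab_word (a b : R) n : exists w, size w = n /\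
  iter n (Tab a b) (0, 1) =
  (bieval (word_poly w).1 (a, b), bieval (word_poly w).2 (a, b)).
Proof.
elim: n => [|n [w [sw e]]].
  by exists [::]; rewrite /bieval /= !hornerE.
exists ((0 <= bieval (word_poly w).1 (a, b)) :: w); split; first by rewrite /= sw.
rewrite iterS e /Tab /= /bieval /=.
by case: ifP => _; rewrite /= !hornerE.
Qed.

Lemma TabZ (a b c : R) p : 0 <= c ->
  Tab a b (c * p.1, c * p.2) = (c * (Tab a b p).1, c * (Tab a b p).2).
Proof.
rewrite le_eqVlt => /predU1P[<-|c0]; rewrite /Tab /=.
  by rewrite !mul0r lexx mulr0 subr0.
by rewrite pmulr_rge0//; case: ifP => _ /=; congr pair; ring.
Qed.

(** By positive homogeneity of [Tab], all normalizations collect into one factor. The value [c = 0]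
    is allowed, so that no norm has to be shown nonzero here. *)
Lemma iter_Sab (a b : R) n p : exists2 c, 0 <= c &
  iter n (Sab a b) p = (c * (iter n (Tab a b) p).1, c * (iter n (Tab a b) p).2).
Proof.
elim: n => [|n [c c0 e]]; first by exists 1; rewrite ?mul1r; case: p.
rewrite !iterS e /Sab TabZ//=.
set u := Tab a b _; set N := norm2 _.
exists (c / N); first by rewrite divr_ge0// norm2_ge0.
by congr pair; ring.
Qed.

(** Periodicity brings back [(0, 1)], and in [Omega_Q] the orbit meets the ray of [(0, -1)]; both
    have abscissa 0. The factor from [iter_Sab] is nonzero there since the ordinate is [-1]. The
    explicit head letter keeps the word nonempty, as [word_poly_neq0] demands. *)
Lemma Omega_word_zero : @Omega_P R `|` @Omega_Q R `<=`
  \bigcup_w [set p | bieval (word_poly (true :: w)).1 p = 0 \/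
                     bieval (word_poly (false :: w)).1 p = 0].
Proof.
move=> [a b] ab.
suff [n n0 e] : exists2 n, (0 < n)%N & (iter n (Tab a b) (0, 1)).1 = 0.
  have [[|c w] [sw ew]] := iter_Tab_word a b n; first by rewrite -sw in n0.
  exists w => //=; rewrite ew in e.
  by case: c e {sw ew} => e; [left|right].
case: ab => [[k /= [k0 Tk]]|[_ [n /= Sn]]]; first by exists k; rewrite ?Tk.
have [c c0] := iter_Sab a b n (0, 1); rewrite Sn => -[e1 e2].
exists n.
  by rewrite lt0n; apply/eqP => n0; move: Sn; rewrite n0 /= => -[]; lra.
apply/eqP; move/esym/eqP: e1; rewrite mulf_eq0 => /predU1P[c00|//].
by move: e2; rewrite c00 mul0r; lra.
Qed.

Lemma hnull_Omega (s : R) : 1 < s -> hnull s (@Omega_P R `|` @Omega_Q R).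
Proof.
move=> s1; apply: hnull_subset Omega_word_zero _.
pose F (cw : bool * seq bool) := [set p | bieval (word_poly (cw.1 :: cw.2)).1 p = 0].
apply: (@hnull_subset _ _ _ (\bigcup_cw F cw)).
  by move=> p [w _ /= [h|h]]; [exists (true, w)|exists (false, w)].
by apply: hnull_bigcup => cw; apply: hnull_zeros => //; exact: word_poly_neq0.
Qed.

End Orbit.

(** * Rotation numbers on the axis b = 0 *)

Section RotationNumber.
Variable R : realType.
Implicit Types (a t r theta : R).

(** As the inverse of [cos] on [[0, pi]], [acos] is continuous within [[-1, 1]]; the range condition
    on [h] turns this into plain continuity of the composite, end points included. *)
Lemma continuous_acos_comp (T : topologicalType) (h : T -> R) :
  continuous h -> (forall x, -1 <= h x <= 1) -> continuous (acos \o h).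
Proof.
move=> ch h1 x.
have : {within `[cos pi, cos (0 : R)], continuous (@acos R)}.
  apply: segment_can_ge_continuous; first exact: pi_ge0.
    exact/continuous_subspaceT/continuous_cos.
  exact: cosK.
rewrite cos0 cospi => /subspace_continuousP /(_ (h x)) /=; rewrite in_itv /= => /(_ (h1 x)) acosh.
move=> A hA; change (\forall y \near x, A (acos (h y))).
have hA' : \forall y \near x, h y \in `[-1, 1] -> A (acos (h y)) :=
  ch x _ (acosh A hA).
by near=> y; apply: (near hA' y) => //; rewrite in_itv /= h1.
Unshelve. all: by end_near.
Qed.

Lemma sqr_norm2 (x y : R) : norm2 (x, y) ^+ 2 = x ^+ 2 + y ^+ 2.
Proof. by rewrite sqr_sqrtr// addr_ge0// sqr_ge0. Qed.

Lemma norm2_gt0 (x y : R) : x ^+ 2 + y ^+ 2 != 0 -> 0 < norm2 (x, y).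
Proof. by move=> h; rewrite sqrtr_gt0 lt_def h addr_ge0// sqr_ge0. Qed.

Lemma div_norm2_itv (x y : R) : 0 < norm2 (x, y) -> -1 <= x / norm2 (x, y) <= 1.
Proof.
move=> N0; rewrite -ler_norml normrM normfV (gtr0_norm N0) ler_pdivrMr// mul1r.
exact: normr_le_norm2.
Qed.

Lemma cos_acos_norm2 (x y : R) : 0 < norm2 (x, y) ->
  cos (acos (x / norm2 (x, y))) = x / norm2 (x, y).
Proof. by move=> N0; rewrite acosK// in_itv /= div_norm2_itv. Qed.

Lemma sin_acos_norm2 (x y : R) : 0 < norm2 (x, y) ->
  sin (acos (x / norm2 (x, y))) = `|y| / norm2 (x, y).
Proof.
move=> N0; rewrite sin_acos ?div_norm2_itv//.
have -> : 1 - (x / norm2 (x, y)) ^+ 2 = (y / norm2 (x, y)) ^+ 2.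
  have N2 : norm2 (x, y) ^+ 2 != 0 by rewrite expf_neq0// gt_eqF.
  rewrite !expr_div_n -[1](divff N2) -mulrBl sqr_norm2.
  by congr (_ / _); ring.
by rewrite sqrtr_sqr normrM normfV (gtr0_norm N0).
Qed.

Lemma Tab0E a (x y : R) : Tab a 0 (x, y) = (a * Num.max x 0 - y, x).
Proof. by rewrite /Tab /=; case: leP => _; rewrite ?mul0r ?mulr0. Qed.

Lemma Tab0_sqr_neq0 a (x y : R) : x ^+ 2 + y ^+ 2 = 1 ->
  (a * Num.max x 0 - y) ^+ 2 + x ^+ 2 != 0.
Proof.
move=> xy; apply/negP; rewrite paddr_eq0 ?sqr_ge0// !sqrf_eq0 => /andP[/[swap]].
move=> /eqP x0; rewrite x0 maxxx mulr0 sub0r oppr_eq0 => /eqP y0.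
by move: xy; rewrite x0 y0 expr0n addr0 => /eqP; rewrite eq_sym oner_eq0.
Qed.

Definition lift_abscissa a t : R := a * Num.max (cos (2 * pi * t)) 0 - sin (2 * pi * t).

(* [T_(a,0)] is the quarter turn followed by a horizontal shear, so the angle
   of the image exceeds that of the quarter turn by a difference of two arc
   cosines; it vanishes on the left half-plane. *)
Definition lift_S a t : R :=
  t + 1 / 4 + (acos (lift_abscissa a t / norm2 (lift_abscissa a t, cos (2 * pi * t)))
               - acos (- sin (2 * pi * t))) / (2 * pi).

Lemma lift_norm_gt0 a t : 0 < norm2 (lift_abscissa a t, cos (2 * pi * t)).
Proof. by apply: norm2_gt0; apply: Tab0_sqr_neq0; rewrite cos2Dsin2. Qed.

Lemma continuous_lift_S a : continuous (lift_S a).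
Proof.
have clin : continuous (fun t : R => 2 * pi * t) by exact: mulrl_continuous.
have cc : continuous (fun t : R => cos (2 * pi * t)).
  by move=> t; apply: continuous_comp; [exact: clin|exact: continuous_cos].
have cs : continuous (fun t : R => sin (2 * pi * t)).
  by move=> t; apply: continuous_comp; [exact: clin|exact: continuous_sin].
have cx : continuous (lift_abscissa a).
  move=> t; apply: cvgB; last exact: cs.
  apply: cvgM; first exact: cvg_cst.
  by apply: (continuous_max (cc t)); exact: cst_continuous.
have cN : continuous (fun t => norm2 (lift_abscissa a t, cos (2 * pi * t))).
  move=> t; apply: (@continuous_comp _ _ _
    (fun t => lift_abscissa a t ^+ 2 + cos (2 * pi * t) ^+ 2) Num.sqrt); last first.
    exact: sqrt_continuous.
  apply: cvgD.
    by apply: (@continuous_comp _ _ _ (lift_abscissa a) (fun x : R => x ^+ 2));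
      [exact: cx|exact: exprn_continuous].
  by apply: (@continuous_comp _ _ _ (fun t => cos (2 * pi * t)) (fun x : R => x ^+ 2));
    [exact: cc|exact: exprn_continuous].
move=> t; apply: cvgD; first by apply: cvgD; [exact: cvg_id|exact: cvg_cst].
apply: cvgM; last exact: cvg_cst.
apply: cvgB.
  apply: (@continuous_acos_comp _
    (fun t => lift_abscissa a t / norm2 (lift_abscissa a t, cos (2 * pi * t)))) => {}t.
    by apply: cvgM; [exact: cx|apply: cvgV; [rewrite gt_eqF// lift_norm_gt0|exact: cN]].
  exact/div_norm2_itv/lift_norm_gt0.
apply: (@continuous_acos_comp _ (fun t => - sin (2 * pi * t))) => {}t.
  by apply: cvgN; exact: cs.
by rewrite lerN2 sin_le1 lerNl sin_geN1.
Qed.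

Lemma trig_natD t (k : nat) : (cos (2 * pi * (t + k%:R)) = cos (2 * pi * t)) *
  (sin (2 * pi * (t + k%:R)) = sin (2 * pi * t)).
Proof.
have -> : 2 * pi * (t + k%:R) = 2 * pi * t + (pi *+ 2) *+ k :> R.
  by rewrite -mulr_natr -[pi *+ 2]mulr_natr; ring.
by rewrite (periodicn (@cosD2pi R)) (periodicn (@sinD2pi R)).
Qed.

Lemma lift_S1 a t : lift_S a (t + 1) = lift_S a t + 1.
Proof.
by rewrite /lift_S /lift_abscissa -[1 in LHS]/(1%:R) !trig_natD; ring.
Qed.

Lemma lift_S_correct a t : Sab a 0 (ecirc t) = ecirc (lift_S a t).
Proof.
have N0 := lift_norm_gt0 a t.
have pi0 : (pi : R) != 0 by rewrite gt_eqF// pi_gt0.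
rewrite /Sab /ecirc Tab0E -/(lift_abscissa a t) /=.
have -> : 2 * pi * lift_S a t = 2 * pi * t + pi / 2 +
    (acos (lift_abscissa a t / norm2 (lift_abscissa a t, cos (2 * pi * t)))
               - acos (- sin (2 * pi * t))).
  rewrite /lift_S; move: (acos _ - acos _) => A.
  by move: pi pi0 {N0} => p p0; field.
have e1 : norm2 (- sin (2 * pi * t), cos (2 * pi * t)) = 1.
  by rewrite /norm2 /= sqrrN addrC cos2Dsin2 sqrtr1.
(* For a negative cosine the two arc cosines cancel. Otherwise the image and the quarter turn both
   have nonnegative ordinate, so their arc cosines are their true angles. *)
have [c0|c0] := leP 0 (cos (2 * pi * t)); last first.
  have -> : lift_abscissa a t = - sin (2 * pi * t).
    by rewrite /lift_abscissa max_r ?ltW// mulr0 sub0r.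
  by rewrite e1 !divr1 subrr addr0 cosDpihalf sinDpihalf.
have [cb sb] : cos (acos (- sin (2 * pi * t))) = - sin (2 * pi * t) /\
    sin (acos (- sin (2 * pi * t))) = cos (2 * pi * t).
  have := @cos_acos_norm2 (- sin (2 * pi * t)) (cos (2 * pi * t)).
  have := @sin_acos_norm2 (- sin (2 * pi * t)) (cos (2 * pi * t)).
  by rewrite e1 !divr1 ltr01 ger0_norm// => -> // ->.
have sa := sin_acos_norm2 N0; rewrite ger0_norm// in sa.
rewrite cosD [sin (_ + _ + _)]sinD cosDpihalf sinDpihalf cosB sinB.
rewrite cb sb sa cos_acos_norm2//.
set x := lift_abscissa a t / _; set y := _ / norm2 _.
have := cos2Dsin2 (2 * pi * t); set C := cos _; set S := sin _ => CS.
(* The rotations cancel up to a factor [C ^ 2 + S ^ 2 = 1]. *)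
by congr pair; rewrite -[LHS]mulr1 -CS; ring.
Qed.

(** Here [acos (- sin (2 * pi * t))] equals [2 * pi * (t - k) + pi / 2], so [lift_S a t - k] reduces
    to an arc cosine over [2 * pi]. The right half-plane thus goes to the upper one within the same
    turn. *)
Lemma lift_S_right a t (k : nat) : 0 <= cos (2 * pi * t) ->
  -(1 / 4) <= t - k%:R <= 1 / 4 -> 0 <= lift_S a t - k%:R <= 1 / 2.
Proof.
move=> c0 tk; have p0 := @pi_gt0 R.
have ea : acos (- sin (2 * pi * t)) = 2 * pi * (t - k%:R) + pi / 2.
  rewrite -[t in LHS](subrK k%:R) trig_natD -cosDpihalf cosK//.
  by rewrite in_itv /=; move: tk => /andP[? ?]; apply/andP; split; nra.
have N := div_norm2_itv (lift_norm_gt0 a t).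
have := acos_ge0 N; have := acos_lepi N.
rewrite /lift_S ea; move: (acos _) => A A1 A0.
have -> : t + 1 / 4 + (A - (2 * pi * (t - k%:R) + pi / 2)) / (2 * pi) - k%:R =
  A / (2 * pi).
  have pn : (pi : R) != 0 by rewrite gt_eqF.
  by move: pi pn {p0 N c0 tk ea A1 A0} => p pn; field.
apply/andP; split; first by rewrite divr_ge0// mulr_ge0// ltW.
by rewrite ler_pdivrMr ?mulr_gt0//; lra.
Qed.

Lemma lift_S_left a t : cos (2 * pi * t) <= 0 -> lift_S a t = t + 1 / 4.
Proof.
move=> c0; rewrite /lift_S /lift_abscissa max_r// mulr0 sub0r.
have -> : norm2 (- sin (2 * pi * t), cos (2 * pi * t)) = 1.
  by rewrite /norm2 /= sqrrN addrC cos2Dsin2 sqrtr1.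
by rewrite divr1 subrr mul0r addr0.
Qed.

Lemma cos_quarter t (k : nat) : -(1 / 4) <= t - k%:R < 3 / 4 ->
  (0 <= cos (2 * pi * t)) = (t - k%:R <= 1 / 4).
Proof.
move=> /andP[t1 t2]; have p0 := @pi_gt0 R.
rewrite -{1}[t](subrK k%:R) trig_natD; move: (t - _) t1 t2 => {}t t1 t2.
have [t3|t3] := leP t (1 / 4).
  by apply: cos_ge0_pihalf; apply/andP; split; nra.
rewrite -[2 * pi * t](subrK pi) cosDpi oppr_ge0; apply/negbTE; rewrite -ltNge.
by apply: cos_gt0_pihalf; apply/andP; split; nra.
Qed.

Lemma sin_half t (k : nat) : 1 / 4 < t - k%:R < 3 / 4 ->
  (0 < sin (2 * pi * t)) = (t - k%:R < 1 / 2).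
Proof.
move=> /andP[t1 t2]; have p0 := @pi_gt0 R.
rewrite -{1}[t](subrK k%:R) trig_natD; move: (t - _) t1 t2 => {}t t1 t2.
have [t3|t3] := ltP t (1 / 2).
  by apply: sin_gt0_pi; apply/andP; split; nra.
rewrite -[2 * pi * t](subrK pi) sinDpi oppr_gt0; apply/negbTE; rewrite -leNgt.
by apply: sin_ge0_pi; apply/andP; split; nra.
Qed.

(* One period [0 <= r < pi + 2 theta] of an invariant curve of
   [T_(2 cos theta, 0)], on which the map is [r |-> r + theta]. *)
Definition curve theta r : R * R :=
  if r < pi + theta then (sin r, sin (r - theta))
  else (- sin (r - 2 * theta), sin (r - theta)).

Lemma sinBpi (x : R) : sin (x - pi) = - sin x.
Proof. by rewrite -[x in RHS](subrK pi) sinDpi opprK. Qed.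

Lemma curve_right theta r : 0 < theta < pi -> 0 <= r <= pi ->
  curve theta r = (sin r, sin (r - theta)).
Proof. by move=> /andP[? ?] /andP[? ?]; rewrite /curve ifT//; lra. Qed.

Lemma curve_x_ge0 theta r : 0 < theta < pi -> 0 <= r < pi + 2 * theta ->
  (0 <= (curve theta r).1) = (r <= pi).
Proof.
move=> /andP[th0 th1] /andP[r0 r1]; rewrite /curve; case: (ltP r) => rt /=.
  have [rp|rp] := leP r pi; first by rewrite sin_ge0_pi// r0.
  rewrite -[r](subrK pi) sinDpi oppr_ge0; apply/negbTE; rewrite -ltNge.
  by apply: sin_gt0_pi; apply/andP; split; lra.
rewrite oppr_ge0 [RHS]leNgt (_ : pi < r); last by lra.
apply/negbTE; rewrite -ltNge.
by apply: sin_gt0_pi; apply/andP; split; lra.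
Qed.

Lemma curve_y_gt0 theta r : 0 < theta < pi -> pi < r < pi + 2 * theta ->
  (0 < (curve theta r).2) = (r < pi + theta).
Proof.
move=> /andP[th0 th1] /andP[r0 r1]; rewrite /curve; case: (ltP r) => rt /=.
  by rewrite sin_gt0_pi//; apply/andP; split; lra.
rewrite -[r - theta](subrK pi) sinDpi oppr_gt0; apply/negbTE; rewrite -leNgt.
by apply: sin_ge0_pi; apply/andP; split; lra.
Qed.

(** For [r <= pi] this is the identity [2 cos theta sin r - sin (r - theta) = sin (r + theta)];
    beyond [pi] the abscissa is negative and the map is a quarter turn. *)
Lemma Tab_curve theta r : 0 < theta < pi -> 0 <= r < pi + theta ->
  Tab (2 * cos theta) 0 (curve theta r) = curve theta (r + theta).
Proof.
move=> th /andP[r0 r1]; have /andP[th0 th1] := th.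
have := curve_x_ge0 th (r := r); rewrite r0 /=.
have -> : r < pi + 2 * theta by lra.
move=> /(_ isT); rewrite {1}/curve {1}/curve r1 /= Tab0E => hx.
have e1 : sin (r + theta - theta) = sin r by congr sin; ring.
rewrite /curve e1; have [rp|rp] := leP r pi; rewrite ?rp ?[r <= pi]leNgt ?rp in hx.
  rewrite max_l ?hx//.
  have e2 : 2 * cos theta * sin r - sin (r - theta) = sin (r + theta).
    by rewrite sinB sinD; ring.
  rewrite e2; case: ltP => // rt.
  (* Only the junction of the two formulas for [curve] remains, where they agree. *)
  have -> : r = pi by lra.
  have -> : pi + theta - 2 * theta = pi - theta by ring.
  by rewrite [pi + _]addrC sinDpi sinB sinpi cospi; congr pair; ring.
rewrite max_r ?mulr0 ?sub0r; last by rewrite ltW// ltNge hx.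
rewrite ifF; last by apply/negbTE; rewrite -leNgt; lra.
by congr (- sin _, _); ring.
Qed.

Lemma Tab_curve_wrap theta r : 0 < theta < pi -> pi + theta <= r < pi + 2 * theta ->
  Tab (2 * cos theta) 0 (curve theta r) = curve theta (r + theta - (pi + 2 * theta)).
Proof.
move=> th /andP[r0 r1]; have /andP[th0 th1] := th.
have hx : ~~ (0 <= (curve theta r).1).
  by rewrite curve_x_ge0// -?ltNge; [lra|apply/andP; split; lra].
move: hx; rewrite {1 2}/curve ltNge r0 /= Tab0E => hx.
rewrite max_r ?mulr0 ?sub0r; last by rewrite ltW// ltNge.
rewrite curve_right//; last by apply/andP; split; lra.
have -> : r + theta - (pi + 2 * theta) - theta = r - 2 * theta - pi by ring.
have -> : r + theta - (pi + 2 * theta) = r - theta - pi by ring.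
by rewrite !sinBpi.
Qed.

(** The phase [s] and the lifted angle [t] have completed the same number [k] of turns and point in
    the same direction. The window for [t - k] starts at [-1/4] because [curve theta 0] points along
    [(0, -1)]. *)
Definition synchronized theta (s t : R) := exists (k : nat) (r c : R),
  [/\ 0 <= r < pi + 2 * theta, s = k%:R * (pi + 2 * theta) + r,
      -(1 / 4) <= t - k%:R < 3 / 4, 0 < c &
      ecirc t = (c * (curve theta r).1, c * (curve theta r).2)].

(** Three cases: from the right half-plane ([r <= pi]) and from the open upper left quadrant
    ([pi < r < pi + theta]) no turn is completed; from the rest of the left half-plane both counters
    advance, [t] passing [k + 3/4] exactly when [r] passes the period. *)
Lemma synchronized_step theta s t : 0 < theta < pi -> synchronized theta s t ->
  synchronized theta (s + theta) (lift_S (2 * cos theta) t).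
Proof.
move=> th [k [r [c [rL sE tk c0 ct]]]]; have /andP[th0 th1] := th.
have /andP[r0 r1] := rL; have /andP[t0 t1] := tk.
pose a := 2 * cos theta.
have [c' c'0 Ft] : exists2 c', 0 < c' & ecirc (lift_S a t) =
    (c' * (Tab a 0 (curve theta r)).1, c' * (Tab a 0 (curve theta r)).2).
  rewrite -lift_S_correct /Sab.
  have N0 : 0 < norm2 (Tab a 0 (ecirc t)).
    by rewrite /ecirc Tab0E; exact: lift_norm_gt0.
  exists (c / norm2 (Tab a 0 (ecirc t))); first by rewrite divr_gt0.
  move: N0; rewrite ct TabZ ?ltW//=; set N := norm2 _ => N0.
  by congr pair; rewrite mulrAC.
have ccE : cos (2 * pi * t) = c * (curve theta r).1 by case: ct.
have ssE : sin (2 * pi * t) = c * (curve theta r).2 by case: ct.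
have [rp|rp] := leP r pi.
  have cge : 0 <= cos (2 * pi * t) by rewrite ccE mulr_ge0 ?(ltW c0)// curve_x_ge0.
  have t2 : t - k%:R <= 1 / 4 by rewrite -(cos_quarter tk).
  exists k, (r + theta), c'; split => //.
  - by apply/andP; split; lra.
  - by rewrite sE addrA.
  - have /andP[? ?] : 0 <= lift_S a t - k%:R <= 1 / 2.
      by apply: lift_S_right => //; apply/andP; split; lra.
    by rewrite -/a; apply/andP; split; lra.
  - by rewrite Ft Tab_curve//; apply/andP; split; lra.
have clt : cos (2 * pi * t) < 0.
  by rewrite ccE pmulr_rlt0// ltNge curve_x_ge0// -ltNge.
have t2 : 1 / 4 < t - k%:R by rewrite ltNge -(cos_quarter tk) -ltNge.
have Fl : lift_S a t = t + 1 / 4 by rewrite lift_S_left// ltW.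
have ty : (t - k%:R < 1 / 2) = (r < pi + theta).
  rewrite -sin_half; last by apply/andP.
  by rewrite ssE pmulr_rgt0// curve_y_gt0// rp.
have [rq|rq] := ltP r (pi + theta); rewrite -/a Fl.
  have t3 : t - k%:R < 1 / 2 by rewrite ty.
  exists k, (r + theta), c'; split => //.
  - by apply/andP; split; lra.
  - by rewrite sE addrA.
  - by apply/andP; split; lra.
  - by rewrite -Fl Ft Tab_curve// r0.
have t3 : 1 / 2 <= t - k%:R by rewrite leNgt ty -leNgt.
exists k.+1, (r + theta - (pi + 2 * theta)), c'; split => //.
- by apply/andP; split; lra.
- by rewrite sE -natr1; ring.
- by rewrite -[k.+1%:R]natr1; apply/andP; split; lra.
- by rewrite -Fl Ft Tab_curve_wrap// rq.
Qed.

Lemma synchronized_iter theta n : 0 < theta < pi ->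
  synchronized theta (n.+1%:R * theta) (iter n (lift_S (2 * cos theta)) 0).
Proof.
move=> th; have /andP[th0 th1] := th.
elim: n => [|n IH]; last first.
  by rewrite -natr1 mulrDl mul1r iterS; exact: synchronized_step.
have s0 : 0 < sin theta by exact: sin_gt0_pi.
(* The angle 0 is the direction of [curve theta theta = (sin theta, 0)], hence the phase starts at
   [theta] and runs as [n.+1 * theta]. *)
exists 0%N, theta, (sin theta)^-1; split.
- by apply/andP; split; lra.
- by rewrite mul1r mul0r add0r.
- by rewrite /= subr0; apply/andP; split; lra.
- by rewrite invr_gt0.
- rewrite curve_right//; last by apply/andP; split; lra.
  by rewrite /ecirc /= mulr0 cos0 sin0 subrr sin0 mulr0 mulVf// gt_eqF.
Qed.

Lemma rotation_number theta : 0 < theta < pi ->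
  (fun n : nat => iter n (lift_S (2 * cos theta)) 0 / n%:R) @ \oo -->
    theta / (pi + 2 * theta).
Proof.
move=> th; have /andP[th0 th1] := th; have p0 := @pi_gt0 R.
set L := pi + 2 * theta; have L0 : 0 < L by rewrite /L; lra.
apply/cvgrPdist_le => e e0.
near=> n.
have n0 : 0 < n%:R :> R.
  by rewrite ltr0n; near: n; exact: nbhs_infty_gt.
(* By synchronization, [n * theta / L] and the [n]-th iterate both lie within a bounded distance of
   the same integer [k]; 3 amply bounds their difference. *)
have ne : 3 <= e * n%:R.
  by rewrite mulrC -ler_pdivrMr//; near: n; exact: nbhs_infty_ger.
have [k [r [c [/andP[r0 r1] sE /andP[t0 t1] _ _]]]] := synchronized_iter n th.
set x := iter _ _ _ in t0 t1 *.
have -> : theta / L - x / n%:R = (n%:R * (theta / L) - x) / n%:R.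
  by field; rewrite !gt_eqF.
rewrite normrM normfV (gtr0_norm n0) ler_pdivrMr//; apply: le_trans ne.
have -> : n%:R * (theta / L) = k%:R + r / L - theta / L.
  have -> : n%:R * (theta / L) = (n.+1%:R * theta) / L - theta / L.
    by rewrite -natr1; field; rewrite gt_eqF.
  by rewrite sE -/L; field; rewrite gt_eqF.
have /andP[y0 y1] : 0 <= r / L < 1.
  by rewrite divr_ge0 ?(ltW L0)//= ltr_pdivrMr// mul1r.
have /andP[z0 z1] : 0 <= theta / L < 1.
  by rewrite divr_ge0 ?ltW//= ltr_pdivrMr// mul1r /L; lra.
by rewrite ler_norml; apply/andP; split; lra.
Unshelve. all: by end_near. Qed.

Lemma Omega_Q_axis theta : 0 < theta < pi -> Defs.irrational (theta / (pi + 2 * theta)) ->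
  Omega_Q (2 * cos theta, 0).
Proof.
move=> th irr; split.
  exists (lift_S (2 * cos theta)), (theta / (pi + 2 * theta)); split.
    split; first exact: continuous_lift_S.
    by split=> t; [exact: lift_S1|exact: lift_S_correct].
  by split => //; exact: rotation_number.
(* The orbit is [(0, 1)], [(-1, 0)], [(0, -1)]. *)
exists 2%N; rewrite !iterS /= {2}/Sab Tab0E maxxx mulr0 sub0r /=.
have n1 x y : x ^+ 2 + y ^+ 2 = 1 -> norm2 (x, y) = 1 :> R.
  by rewrite /norm2 /= => ->; rewrite sqrtr1.
rewrite n1; last by rewrite sqrrN expr1n expr0n addr0.
rewrite !divr1 /Sab Tab0E max_r; last by rewrite lerN10.
rewrite mulr0 subr0 /= n1; last by rewrite sqrrN expr1n expr0n add0r.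
by rewrite !divr1.
Qed.

End RotationNumber.

(** * Lower bound by projection of coverings to the axis [b = 0] *)

Section LowerBound.
Variable R : realType.

(** The angle is [theta / (pi + 2 * theta) = q] solved for [theta]. At [q = 1/2] the division by
    zero only adds one stray value to a countable set. *)
Definition rational_parameters : set R :=
  range (fun q : rat => 2 * cos (ratr q * pi / (1 - 2 * ratr q))).

Lemma Omega_Q_segment (a : R) : -1 <= a <= 1 -> ~ rational_parameters a ->
  Omega_Q (a, 0).
Proof.
move=> /andP[a1 a2] na; have p0 := @pi_gt0 R.
have a21 : -1 <= a / 2 <= 1 by apply/andP; split; lra.
have aE : a = 2 * cos (acos (a / 2)) by rewrite acosK ?in_itv//=; field.
have t0 : 0 < acos (a / 2) by apply: acos_gt0; apply/andP; split; lra.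
have t1 : acos (a / 2) < pi by apply: acos_ltpi; apply/andP; split; lra.
move: (acos _) aE t0 t1 => theta aE t0 t1 {a1 a2 a21}.
rewrite aE; apply: Omega_Q_axis; first by rewrite t0.
move=> [q qE]; apply: na; exists q => //; rewrite aE; congr (2 * cos _).
have e : theta = ratr q * (pi + 2 * theta).
  by rewrite -qE divfK// gt_eqF//; lra.
have e2 : theta * (1 - 2 * ratr q) = ratr q * pi by rewrite mulrBr mulr1 {1}e; ring.
have q2 : 1 - 2 * ratr q != 0 :> R.
  apply/eqP => q2; move: e2; rewrite q2 mulr0 => /esym/eqP.
  by rewrite mulf_eq0 (gt_eqF p0) orbF => /eqP q0; move: q2; rewrite q0; lra.
by rewrite -e2 mulfK.
Qed.

(* A set of diameter [d <= 1] projects into an interval of length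
   [2 d <= 2 d ^ s]. *)
Lemma projection_cover (s : R) (A : set (R * R)) : s <= 1 -> (diam A <= 1%:E)%E ->
  exists V : set R, [/\ measurable V, (forall p, A p -> V p.1) &
    (lebesgue_measure V <= 2%:E * diam_pow s A)%E].
Proof.
move=> s1; have [->|nA] := pselect (A = set0).
  exists set0; split => //; rewrite measure0 mule_ge0// ?lee_fin//.
  exact: diam_pow_ge0.
have [p Ap] : A !=set0 by apply/set0P/eqP.
have := @diam_ge _ _ _ _ Ap; have := @diam_ge _ _ _ _ Ap Ap.
rewrite /diam_pow; case: pselect => // A0.
case: (diam A) => // d; rewrite lee_fin => d0 hd; rewrite lee_fin => d1.
have {}d0 : 0 <= d := le_trans (dist2_ge0 _ _) d0.
exists `[p.1 - d, p.1 + d]%classic; split.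
- exact: measurable_itv.
- move=> q /hd; rewrite lee_fin => pq; rewrite /= in_itv /=.
  have := le_trans (normr_le_norm2 _ _) pq; rewrite ler_norml => /andP[? ?].
  by apply/andP; split; lra.
- rewrite lebesgue_measure_itv /= lte_fin -EFinM.
  have dd : 2 * d <= 2 * d `^ s.
    rewrite ler_pM2l//; move: d0; rewrite le_eqVlt => /predU1P[<-|d0].
      exact: powR_ge0.
    by rewrite -[leLHS]powRr1 ?(ltW d0)//; apply: ger_powR; rewrite ?d0.
  case: ifP => _; last by rewrite lee_fin mulr_ge0// powR_ge0.
  by rewrite -EFinB lee_fin; lra.
Qed.

(** A covering of cost at most [1/2] would project, with the factor 2 of [projection_cover], to sets
    of total length at most 1. Together with the countable exceptional set they would cover
    [[-1, 1]], which has length 2. *)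
Lemma not_hnull_Omega (s : R) : s < 1 -> ~ hnull s (@Omega_P R `|` @Omega_Q R).
Proof.
move=> s1 /(_ 1 (1 / 2) ltr01 _)[|U [EU dU sU]]; first by rewrite divr_gt0.
have /choice[V PV] i := projection_cover (ltW s1) (dU i).
have mV i : measurable (V i) by have [] := PV i.
have cB : countable rational_parameters.
  exact: (sub_countable (card_image_le _ _)).
have mB : measurable rational_parameters.
  by apply: countable_measurable => // t; exact: measurable_set1.
have mUV : measurable (\bigcup_i V i) by exact: bigcupT_measurable.
have cover : `[-1, 1]%classic `<=` rational_parameters `|` \bigcup_i V i.
  move=> a /=; rewrite in_itv /= => a1.
  have [?|na] := pselect (rational_parameters a); [by left|right].
  have [|i _ Ui] := EU (a, 0); first by right; exact: Omega_Q_segment.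
  by exists i => //; have [_ /(_ _ Ui)] := PV i.
have : (lebesgue_measure (`[(-1)%R, 1%R] : set R) <= 1%:E)%E.
  apply: (@le_trans _ _ (lebesgue_measure (rational_parameters `|` \bigcup_i V i))).
    by apply: le_measure; rewrite ?inE//; exact: measurableU.
  apply: (le_trans (@measureU2 _ _ _ lebesgue_measure _ _ mB mUV)).
  rewrite [X in (X + _)%E]countable_lebesgue_measure0// add0e.
  apply: (@le_trans _ _ (\sum_(0 <= i <oo) lebesgue_measure (V i))%E).
    exact: measure_sigma_subadditive.
  apply: (@le_trans _ _ (\sum_(0 <= i <oo) (2%:E * diam_pow s (U i)))%E).
    by apply: lee_nneseries => // i _; have [] := PV i.
  rewrite nneseriesZl; last by move=> *; exact: diam_pow_ge0.
  apply: (@le_trans _ _ (2%:E * (1 / 2)%:E)%E); first by rewrite lee_pmul2l.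
  by rewrite -EFinM lee_fin; lra.
by rewrite lebesgue_measure_itv /= lte_fin; case: ifP; rewrite -?EFinB ?lee_fin; lra.
Qed.

End LowerBound.

Theorem theorem5p1 (R : realType) :
  @hausdorff_dim R (@Omega_P R `|` @Omega_Q R) = 1%:E.
Proof.
apply/eqP; rewrite eq_le; apply/andP; split.
  apply/lee_addgt0Pr => e e0; rewrite -EFinD.
  apply: (@ereal_inf_lbound R); exists (1 + e) => //=.
  split; first by rewrite addr_ge0// ltW.
  by apply: hausdorff_measure_eq0; apply: hnull_Omega; rewrite ltrDl.
apply: (@le_ereal_inf_tmp R) => _ [s [_ hs] <-].
rewrite lee_fin leNgt; apply/negP => s1.
exact: (not_hnull_Omega s1 (hnull_of_measure_eq0 hs)).
Qed.
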